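(* Let $m \in \{6, 12, 18, 30, 42\}$, write $m = 2k$, let $n \ge 3$, and let $\mathcal{A}$ be an $m$th order $n$ dimensional generalized anti-circulant tensor with circulant index $r = 3$ and generating vector $\mathbf{v} = (v_0, \dots, v_{(n-1)m})^\top$. Then $\mathcal{A}$ is PSD if and only if $v_0 = v_1 = v_2 \ge 0$. In this case, $$f(\mathbf{x}) = v_0 (x_1 + \cdots + x_n)^m \quad \text{for all } \mathbf{x} \in \mathbb{R}^n,$$ and $$\mathbf{y}^\top A \mathbf{y} = v_0 \left(y_1 + \cdots + y_{nk-k+1}\right)^2 \quad \text{for all } \mathbf{y} \in \mathbb{R}^{nk-k+1},$$ where $f$ is the Hankel polynomial of $\mathcal{A}$ and $A$ is the associated Hankel matrix; consequently $\mathcal{A}$ is a strong Hankel tensor and hence an SOS Hankel tensor.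
   Context: Let $m, n \ge 2$ and $\mathbf{v} = (v_0, \dots, v_{(n-1)m})^\top \in \mathbb{R}^{(n-1)m+1}$. The $m$th order $n$ dimensional Hankel tensor with generating vector $\mathbf{v}$ is $\mathcal{A} = (a_{i_1 \cdots i_m})$ with $a_{i_1\cdots i_m} = v_{i_1 + \cdots + i_m - m}$ for $i_1, \dots, i_m = 1, \dots, n$. Given $1 \le r \le n$, $\mathcal{A}$ is called a generalized anti-circulant tensor with circulant index $r$ if $v_i = v_{i+r}$ for all $i = 0, \dots, (n-1)m - r$. The Hankel polynomial of $\mathcal{A}$ is $f(\mathbf{x}) = \sum_{i_1, \dots, i_m = 1}^n v_{i_1 + \cdots + i_m - m}\, x_{i_1} \cdots x_{i_m}$ for $\mathbf{x} = (x_1, \dots, x_n)^\top \in \mathbb{R}^n$. Let $m = 2k$ be even. $\mathcal{A}$ is PSD (positive semi-definite) if $f(\mathbf{x}) \ge 0$ for all $\mathbf{x} \in \mathbb{R}^n$. $\mathcal{A}$ is an SOS Hankel tensor if $f$ is a sum of squares of polynomials of degree $k$. The associated Hankel matrix is the $(nk-k+1)\times(nk-k+1)$ matrix $A = (a_{ij})$ with $a_{ij} = v_{i+j-2}$ for $i, j = 1, \dots, nk-k+1$. $\mathcal{A}$ is a strong Hankel tensor if $A$ is positive semi-definite. *)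

(* Defs.v *)
From HB Require Import structures.
From mathcomp Require Import all_boot all_order all_algebra.
From mathcomp Require Import reals.
From mathcomp Require Import mpoly.

Set Implicit Arguments.
Unset Strict Implicit.
Unset Printing Implicit Defensive.

Import Order.TTheory GRing.Theory Num.Theory.
Local Open Scope ring_scope.

(* [gen_entry v s] is the entry v_s of v = (v_0, ..., v_N)^T.  The [inord]
   default value (at ord0) is never reached below: every index s used satisfies
   s <= N, provided m = 2 * k in the case of [hankel_matrix]. *)
Definition gen_entry (R : realType) (N : nat) (v : 'cV[R]_N.+1) (s : nat) : R :=
  v (inord s) ord0.

(* A multi-index is a function 'I_m -> 'I_n; its components are counted from 0,
   so that the index i_1 + ... + i_m - m of the usual definition, in which
   each i_j ranges over 1, ..., n, becomes the plain sum. *)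
Definition hankel_tensor (R : realType) (m n : nat)
    (v : 'cV[R]_((n - 1) * m).+1) : {ffun {ffun 'I_m -> 'I_n} -> R} :=
  [ffun i : {ffun 'I_m -> 'I_n} => gen_entry v (\sum_(j < m) i j)%N].

Definition hankel_poly (R : realType) (m n : nat)
    (v : 'cV[R]_((n - 1) * m).+1) : {mpoly R[n]} :=
  \sum_(i : {ffun 'I_m -> 'I_n}) hankel_tensor v i *: \prod_(j < m) 'X_(i j).

Definition hankel_form (R : realType) (m n : nat)
    (v : 'cV[R]_((n - 1) * m).+1) (x : 'cV[R]_n) : R :=
  (hankel_poly v).@[fun i => x i ord0].

Definition gen_anticirculant (R : realType) (m n r : nat)
    (v : 'cV[R]_((n - 1) * m).+1) : Prop :=
  (1 <= r <= n)%N /\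
  forall i : nat, (i + r <= (n - 1) * m)%N ->
    gen_entry v i = gen_entry v (i + r).

Definition psd_hankel (R : realType) (m n : nat)
    (v : 'cV[R]_((n - 1) * m).+1) : Prop :=
  forall x : 'cV[R]_n, 0 <= hankel_form v x.

(* [msize q = k.+1] says that q has total degree exactly k.  The sum may be
   empty, so that the zero form is a sum of squares. *)
Definition sos_hankel (R : realType) (m n k : nat)
    (v : 'cV[R]_((n - 1) * m).+1) : Prop :=
  exists s : seq {mpoly R[n]},
    (forall q, q \in s -> msize q = k.+1) /\
    hankel_poly v = \sum_(q <- s) q ^+ 2.

Definition hankel_matrix (R : realType) (m n k : nat)
    (v : 'cV[R]_((n - 1) * m).+1) : 'M[R]_((n * k - k).+1) :=
  \matrix_(i, j) gen_entry v (i + j)%N.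

Definition quad_form (R : realType) (p : nat) (A : 'M[R]_p) (y : 'cV[R]_p) : R :=
  (y^T *m A *m y) ord0 ord0.

Definition psd_matrix (R : realType) (p : nat) (A : 'M[R]_p) : Prop :=
  A^T = A /\ forall y : 'cV[R]_p, 0 <= quad_form A y.

Definition strong_hankel (R : realType) (m n k : nat)
    (v : 'cV[R]_((n - 1) * m).+1) : Prop :=
  psd_matrix (hankel_matrix k v).

(* Main.v *)
Require Import Defs.
From HB Require Import structures.
From mathcomp Require Import all_boot all_order all_algebra.
From mathcomp Require Import reals.
From mathcomp Require Import mpoly.
From mathcomp Require Import complex ring zify.

(** A generating vector of period 3 is, by the discrete Fourier transform on
    Z/3, a combination of the three geometric sequences of ratio 1, w and w^2,
    where w is a primitive cube root of unity in R[i].  A geometric generating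
    vector of ratio u has for Hankel form the m-th power of the linear form
    z_u = sum_i u^i x_i (lemma [sum_ffun_geometric]), so that
    [[
      3 f(x) = d_0 z_1^m + conj(d) z_w^m + d z_(w^2)^m
    ]]
    with d_0 real and d complex (lemma [hankel_form_dft3]).  For a real vector x,
    z_1 is real and z_(w^2) is the conjugate of z_w; conversely, as soon as
    n >= 3, some real x realizes z_1 = 0 together with any prescribed complex
    value of z_w (lemma [dft3_surj_sum0]).

    Since R[i] is algebraically closed, z_w may be chosen with z_w^m = -d, and
    then 3 f(x) = -2 |d|^2.  Positivity of f thus forces d = 0, that is,
    the generating vector is constant (lemmas [psd_gen_symbol_eq0] and
    [psd_gen_entry_const]).  A constant vector c gives
    f(x) = c (x_1 + ... + x_n)^m and the Hankel matrix with all entries c,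
    from which the remaining claims are read off; evaluating f at a basis vector
    gives c >= 0. *)

Set Implicit Arguments.
Unset Strict Implicit.
Unset Printing Implicit Defensive.

Import Order.TTheory GRing.Theory Num.Theory.
Local Open Scope ring_scope.

(** * Hankel forms of geometric and of constant generating vectors *)

(** Since w^(i_1 + ... + i_m) splits as a product over the positions, the sum
    over all multi-indices factors: this is the expansion of the m-th power of
    the linear form with coefficients w^i.  It is used for w a cube root of
    unity, and, with w = 1, over the polynomial ring. *)
Lemma sum_ffun_geometric (A : comNzRingType) (m n : nat) (w : A)
    (F : 'I_n -> A) :
  \sum_(f : {ffun 'I_m -> 'I_n})
      w ^+ (\sum_(j < m) f j)%N * \prod_(j < m) F (f j)
    = (\sum_(i < n) w ^+ i * F i) ^+ m.
Proof.
have -> : (\sum_(i < n) w ^+ i * F i) ^+ m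
    = \prod_(j < m) \sum_(i < n) w ^+ i * F i.
  by rewrite prodr_const card_ord.
rewrite bigA_distr_bigA; apply: eq_bigr => f _.
by rewrite big_split /= prodrXr.
Qed.

Lemma sum_ffun_le (m n : nat) (f : {ffun 'I_m -> 'I_n}) :
  (\sum_(j < m) f j <= (n - 1) * m)%N.
Proof.
have -> : ((n - 1) * m = \sum_(j < m) (n - 1))%N.
  by rewrite sum_nat_const card_ord mulnC.
by apply: leq_sum => j _; have := ltn_ord (f j); lia.
Qed.

Section ConstantGeneratingVector.

Variables (R : realType) (m n : nat) (v : 'cV[R]_((n - 1) * m).+1).

Lemma hankel_formE (x : 'cV[R]_n) :
  hankel_form v x = \sum_(f : {ffun 'I_m -> 'I_n})
    gen_entry v (\sum_(j < m) f j)%N * \prod_(j < m) x (f j) ord0.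
Proof.
rewrite /hankel_form /hankel_poly raddf_sum; apply: eq_bigr => f _ /=.
rewrite mevalZ ffunE rmorph_prod; congr (_ * _).
by apply: eq_bigr => j _; rewrite /= mevalXU.
Qed.

Lemma gen_entry_mod (r s : nat) : gen_anticirculant r v ->
  (s <= (n - 1) * m)%N -> gen_entry v s = gen_entry v (s %% r).
Proof.
move=> [/andP[r_gt0 _] per]; elim/ltn_ind: s => s IH le_s.
have [lt_sr|le_rs] := ltnP s r; first by rewrite modn_small.
rewrite -{1}(subnK le_rs) -per ?subnK //.
rewrite IH; [|lia..].
by rewrite -[in RHS](subnK le_rs) modnDr.
Qed.

Lemma hankel_poly_const (c : R) :
  (forall s, (s <= (n - 1) * m)%N -> gen_entry v s = c) ->
  hankel_poly v = c *: (\sum_(i < n) 'X_i) ^+ m.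
Proof.
move=> vc; have := @sum_ffun_geometric {mpoly R[n]} m n 1 (fun i => 'X_i).
under [in RHS]eq_bigr do rewrite expr1n mul1r.
move=> <-; rewrite scaler_sumr; apply: eq_bigr => f _.
by rewrite expr1n mul1r ffunE vc ?sum_ffun_le.
Qed.

Lemma hankel_form_const (c : R) (x : 'cV[R]_n) :
  (forall s, (s <= (n - 1) * m)%N -> gen_entry v s = c) ->
  hankel_form v x = c * (\sum_(i < n) x i ord0) ^+ m.
Proof.
move=> vc; rewrite /hankel_form (hankel_poly_const vc) mevalZ rmorphXn /=.
rewrite raddf_sum; congr (_ * _ ^+ _).
by apply: eq_bigr => i _; rewrite /= mevalXU.
Qed.

Lemma hankel_matrix_const (k : nat) (c : R) : m = (2 * k)%N ->
  (forall s, (s <= (n - 1) * m)%N -> gen_entry v s = c) ->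
  hankel_matrix k v = const_mx c.
Proof.
move=> mk vc; apply/matrixP => i j; rewrite !mxE; apply: vc.
by have := ltn_ord i; have := ltn_ord j; nia.
Qed.

End ConstantGeneratingVector.

Lemma quad_form_const (R : realType) (p : nat) (c : R) (y : 'cV[R]_p) :
  quad_form (const_mx c) y = c * (\sum_(i < p) y i ord0) ^+ 2.
Proof.
rewrite /quad_form !mxE expr2 mulrA mulr_sumr; apply: eq_bigr => j _.
rewrite !mxE; congr (_ * _); rewrite mulr_sumr; apply: eq_bigr => i _.
by rewrite !mxE mulrC.
Qed.

(** * Sums of squares *)

Lemma sumX_neq0 (R : idomainType) (n : nat) : (0 < n)%N ->
  \sum_(i < n) 'X_i != 0 :> {mpoly R[n]}.
Proof.
case: n => // n _; apply/eqP => /(congr1 (meval (fun i => (i == 0)%:R))).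
rewrite raddf_sum raddf0 big_ord_recl big1 /= ?mevalXU ?addr0 => [|i _].
  by move/eqP; rewrite oner_eq0.
by rewrite mevalXU.
Qed.

(** A nonzero homogeneous polynomial has only one degree of homogeneity, so
    its size is determined by that degree. *)
Lemma msizeZ_sumX_exp (R : idomainType) (n k : nat) (b : R) :
  (0 < n)%N -> b != 0 -> msize (b *: (\sum_(i < n) 'X_i) ^+ k) = k.+1.
Proof.
move=> n_gt0 b_neq0; set q := _ *: _.
have q_neq0 : q != 0.
  by rewrite /q -mul_mpolyC mulf_neq0 ?mpolyC_eq0 ?expf_neq0 ?sumX_neq0.
have qk : q \is k.-homog.
  apply: dhomogZ; rewrite -[k in k.-homog]mul1n; apply: dhomogMn.
  by apply: rpred_sum => i _; rewrite dhomogX /= mdeg1.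
have := dhomog_uniq q_neq0 qk (dhomog_msize qk).
by have := q_neq0; rewrite -msize_poly_eq0; case: (mmeasure _ _) => //= ? _ ->.
Qed.

(** For even m, c S^m is the square of sqrt(c) S^k.  This square root has degree
    k only for c <> 0; the zero form is the empty sum of squares. *)
Lemma sos_hankel_const (R : realType) (m n k : nat)
    (v : 'cV[R]_((n - 1) * m).+1) (c : R) :
  (0 < n)%N -> m = (2 * k)%N -> 0 <= c ->
  (forall s, (s <= (n - 1) * m)%N -> gen_entry v s = c) -> sos_hankel k v.
Proof.
move=> n_gt0 mk c_ge0 vc; rewrite /sos_hankel (hankel_poly_const vc) mk mulnC.
have [->|c_neq0] := eqVneq c 0; first by exists [::]; rewrite scale0r big_nil.
exists [:: Num.sqrt c *: (\sum_(i < n) 'X_i) ^+ k]; split.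
  move=> q; rewrite inE => /eqP ->.
  by rewrite msizeZ_sumX_exp // sqrtr_eq0 -ltNge lt0r c_neq0.
by rewrite big_seq1 exprZn sqr_sqrtr // exprM.
Qed.

(** * The discrete Fourier transform of length 3 *)

Section CubeRootOfUnity.

Variable R : realType.

Local Notation "z ^*" := (conjc z).
Local Notation "x %:C" := (real_complex R x).

Definition cube_root1 : R[i] := Complex (- 2^-1) (Num.sqrt 3 / 2).
Local Notation w := cube_root1.

Lemma cube_root1_conj : w^* = w ^+ 2.
Proof.
have s3 : Num.sqrt (3 : R) ^+ 2 = 3 by rewrite sqr_sqrtr.
apply/eqP; rewrite expr2 eq_complex /=; apply/andP; split; apply/eqP.
  have -> : Num.sqrt (3 : R) / 2 * (Num.sqrt 3 / 2)
      = Num.sqrt (3 : R) ^+ 2 / 4 by field.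
  by rewrite s3; field.
by field.
Qed.

Lemma cube_root1_sum : 1 + w + w ^+ 2 = 0.
Proof.
rewrite -cube_root1_conj; apply/eqP; rewrite eq_complex /=.
by apply/andP; split; apply/eqP; field.
Qed.

Lemma cube_root1_exp3 : w ^+ 3 = 1.
Proof.
apply/eqP; rewrite -subr_eq0.
have -> : w ^+ 3 - 1 = (w - 1) * (1 + w + w ^+ 2) by ring.
by rewrite cube_root1_sum mulr0.
Qed.

(** The reduction rule by which [ring] and [field] decide identities in w. *)
Lemma cube_root1_sqr : w ^+ 2 = - 1 - w.
Proof. by rewrite -[LHS]subr0 -cube_root1_sum; ring. Qed.

(** Fourier inversion for the spectrum (0, z, conj z): this spectrum has the
    conjugation symmetry of the transform of a real vector, so its inverse
    transform x_i = (z w^(-i) + conj(z) w^i) / 3 is real.  The entries beyond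
    the first three are set to zero. *)
Lemma dft3_surj_sum0 (n : nat) (z : R[i]) : (3 <= n)%N ->
  exists x : 'cV[R]_n, [/\ \sum_(i < n) (x i ord0)%:C = 0,
    \sum_(i < n) w ^+ i * (x i ord0)%:C = z &
    \sum_(i < n) (w ^+ 2) ^+ i * (x i ord0)%:C = z^*].
Proof.
case: n => [|[|[|n]]] // _.
pose y i : R := if (i < 3)%N then 2 / 3 * complex.Re (z * (w ^+ 2) ^+ i) else 0.
have n3 : 3 != 0 :> R[i] by rewrite pnatr_eq0.
have n2 : 2 != 0 :> R[i] by rewrite pnatr_eq0.
have yE i : (i < 3)%N -> (y i)%:C = (z * (w ^+ 2) ^+ i + z^* * w ^+ i) / 3.
  move=> i3; rewrite /y i3 -cube_root1_conj.
  have -> : (2 / 3 * complex.Re (z * (w^*) ^+ i))%:C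
      = 2 / 3 * (complex.Re (z * (w^*) ^+ i))%:C.
    by rewrite rmorphM /= rmorphM /= fmorphV !rmorph_nat.
  have conjE (u : R[i]) : (z * (u^*) ^+ i)^* = z^* * u ^+ i.
    by rewrite rmorphM rmorphXn /= conjcK.
  by rewrite ReJ_add conjE; field.
exists (\col_i y i).
have sum3 (F : nat -> R[i]) :
    \sum_(i < n.+3) F i * ((\col_(i < n.+3) y i) i ord0)%:C
      = F 0 * (y 0)%:C + F 1 * (y 1)%:C + F 2 * (y 2)%:C.
  rewrite 3!big_ord_recl big1 ?addr0 => [|i _]; rewrite !mxE /= ?addrA //.
  by rewrite mulr0.
have w2 := cube_root1_sqr.
split.
- have := sum3 (fun=> 1); rewrite !mul1r => E.
  by under eq_bigr do rewrite -[_%:C]mul1r; rewrite E !yE //; field: w2.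
- rewrite (sum3 (fun i => w ^+ i)) !yE //; field: w2 => //.
- rewrite (sum3 (fun i => (w ^+ 2) ^+ i)) !yE //; field: w2 => //.
Qed.

End CubeRootOfUnity.

(** * Generating vectors of period 3 *)

Section Circulant3.

Variables (R : realType) (m n : nat) (v : 'cV[R]_((n - 1) * m).+1).
Hypothesis v_per3 : gen_anticirculant 3 v.

Local Notation "z ^*" := (conjc z).
Local Notation "x %:C" := (real_complex R x).
Local Notation w := (cube_root1 R).

(** The Fourier coefficient of (v_0, v_1, v_2) at the frequency of u^-1, for u
    a cube root of unity. *)
Definition gen_symbol (u : R[i]) : R[i] :=
  (gen_entry v 0)%:C + (gen_entry v 1)%:C * u + (gen_entry v 2)%:C * u ^+ 2.

Lemma gen_symbol_conj (u : R[i]) : (gen_symbol u)^* = gen_symbol u^*.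
Proof.
by rewrite /gen_symbol !(rmorphD conjc, rmorphM conjc, rmorphXn conjc) /= !oppr0.
Qed.

Lemma gen_entry_dft3 (s : nat) : (s <= (n - 1) * m)%N ->
  3 * (gen_entry v s)%:C =
    gen_symbol 1 + gen_symbol (w ^+ 2) * w ^+ s + gen_symbol w * (w ^+ 2) ^+ s.
Proof.
move=> le_s; rewrite (gen_entry_mod v_per3 le_s).
have w_mod : w ^+ s = w ^+ (s %% 3) by rewrite expr_mod ?cube_root1_exp3.
rewrite (exprAC w) w_mod /gen_symbol.
have w2 := cube_root1_sqr R.
have : (s %% 3 < 3)%N by rewrite ltn_mod.
by case: (s %% 3)%N => [|[|[|]]] // _; ring: w2.
Qed.

Lemma hankel_form_dft3 (x : 'cV[R]_n) :
  3 * (hankel_form v x)%:C =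
      gen_symbol 1 * (\sum_(i < n) (x i ord0)%:C) ^+ m
    + gen_symbol (w ^+ 2) * (\sum_(i < n) w ^+ i * (x i ord0)%:C) ^+ m
    + gen_symbol w * (\sum_(i < n) (w ^+ 2) ^+ i * (x i ord0)%:C) ^+ m.
Proof.
have sum1 : \sum_(i < n) (x i ord0)%:C = \sum_(i < n) 1 ^+ i * (x i ord0)%:C.
  by apply: eq_bigr => i _; rewrite expr1n mul1r.
rewrite hankel_formE sum1 -!sum_ffun_geometric rmorph_sum !mulr_sumr -!big_split.
apply: eq_bigr => f _ /=.
rewrite rmorphM rmorph_prod mulrA gen_entry_dft3 ?sum_ffun_le // expr1n.
by rewrite !mulrDl mul1r !mulrA.
Qed.

(** With z^m = -d and vanishing coordinate sum, the two conjugate terms of the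
    Fourier expansion both equal -|d|^2, so that f is negative there unless
    d = 0. *)
Lemma psd_gen_symbol_eq0 : (0 < m)%N -> psd_hankel v -> gen_symbol w = 0.
Proof.
move=> m_gt0 v_psd; have [/andP[_ n_ge3] _] := v_per3.
have [x [x0 x1 x2]] := dft3_surj_sum0 (m.-root (- gen_symbol w)) n_ge3.
have := hankel_form_dft3 x.
rewrite x0 x1 x2 expr0n eqn0Ngt m_gt0 mulr0 add0r -rmorphXn rootCK //.
rewrite -cube_root1_conj -gen_symbol_conj rmorphN.
set d := gen_symbol w => fE.
have fx_ge0 : 0 <= 3 * (hankel_form v x)%:C by rewrite mulr_ge0 ?ler0c ?v_psd.
have d_le0 : d * d^* <= 0.
  rewrite -oppr_ge0 -(@pmulr_rge0 _ 2) //; move: fx_ge0; rewrite fE.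
  by congr (0 <= _); ring.
have : d * d^* == 0 by rewrite eq_le d_le0 mulcJ_ge0.
by rewrite mulf_eq0 conjc_eq0 orbb => /eqP.
Qed.

(** Both nontrivial Fourier coefficients vanish, being conjugate; only the
    constant term of the inversion formula is left. *)
Lemma psd_gen_entry_const (s : nat) : (0 < m)%N -> psd_hankel v ->
  (s <= (n - 1) * m)%N -> gen_entry v s = gen_entry v 0.
Proof.
move=> m_gt0 v_psd le_s; apply: (@complexI R).
have d0 := psd_gen_symbol_eq0 m_gt0 v_psd.
have n3 : 3 != 0 :> R[i] by rewrite pnatr_eq0.
apply: (mulfI n3); rewrite !gen_entry_dft3 //.
by rewrite -cube_root1_conj -gen_symbol_conj d0 conjc0 !mul0r.
Qed.

Lemma psd_gen_entry_ge0 : (0 < m)%N -> psd_hankel v -> 0 <= gen_entry v 0.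
Proof.
move=> m_gt0 v_psd; have [/andP[_ n_ge3] _] := v_per3.
have n_gt0 : (0 < n)%N by apply: ltn_trans n_ge3.
pose e : 'cV[R]_n := delta_mx (Ordinal n_gt0) ord0.
have := v_psd e.
rewrite (hankel_form_const _ (fun s => psd_gen_entry_const m_gt0 v_psd)).
rewrite (bigD1 (Ordinal n_gt0)) //= big1 => [|i i_neq0]; rewrite mxE.
  by rewrite !eqxx addr0 expr1n mulr1.
by rewrite (negPf i_neq0).
Qed.

Lemma gen_entry_const : gen_entry v 0 = gen_entry v 1 ->
  gen_entry v 1 = gen_entry v 2 ->
  forall s, (s <= (n - 1) * m)%N -> gen_entry v s = gen_entry v 0.
Proof.
move=> v01 v12 s le_s; rewrite (gen_entry_mod v_per3 le_s).
have : (s %% 3 < 3)%N by rewrite ltn_mod.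
by case: (s %% 3)%N => [|[|[|]]] // _; rewrite -?v12 -?v01.
Qed.

End Circulant3.

Theorem theorem3 (R : realType) (m k n : nat)
    (hm : m \in [:: 6; 12; 18; 30; 42]%N) (hk : m = (2 * k)%N)
    (hn : (3 <= n)%N)
    (v : 'cV[R]_((n - 1) * m).+1) (hv : gen_anticirculant 3 v) :
  (psd_hankel v <->
     [/\ gen_entry v 0 = gen_entry v 1, gen_entry v 1 = gen_entry v 2
       & 0 <= gen_entry v 2]) /\
  (psd_hankel v ->
     [/\ forall x : 'cV[R]_n,
           hankel_form v x = gen_entry v 0 * (\sum_(i < n) x i ord0) ^+ m,
         forall y : 'cV[R]_((n * k - k).+1),
           quad_form (hankel_matrix k v) y =
             gen_entry v 0 * (\sum_(i < (n * k - k).+1) y i ord0) ^+ 2,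
         strong_hankel k v
       & sos_hankel k v]).
Proof.
have m_gt0 : (0 < m)%N by move: hm; case: (m).
have N_ge2 : (2 <= (n - 1) * m)%N by nia.
split; first split=> [v_psd|[v01 v12 v2_ge0] x].
- have vc s := @psd_gen_entry_const _ _ _ _ hv s m_gt0 v_psd.
  by rewrite (vc 1%N) ?(vc 2) ?(ltnW N_ge2) // psd_gen_entry_ge0.
- rewrite (hankel_form_const _ (gen_entry_const hv v01 v12)) v01 v12.
  by rewrite mulr_ge0 // exprn_even_ge0 // hk oddM.
move=> v_psd; have vc s := @psd_gen_entry_const _ _ _ _ hv s m_gt0 v_psd.
have v0_ge0 := psd_gen_entry_ge0 hv m_gt0 v_psd.
have quadE y : quad_form (hankel_matrix k v) y =
    gen_entry v 0 * (\sum_(i < (n * k - k).+1) y i ord0) ^+ 2.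
  by rewrite (hankel_matrix_const hk vc); exact: quad_form_const.
split=> [x|//||].
- exact: hankel_form_const.
- split; first by rewrite (hankel_matrix_const hk vc) trmx_const.
  by move=> y; rewrite quadE mulr_ge0 ?sqr_ge0.
- by apply: (sos_hankel_const _ hk v0_ge0 vc); apply: ltn_trans hn.
Qed.
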